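(* Let $b=b_1\otimes\cdots\otimes b_L\in B_{\lambda_1}\otimes\cdots\otimes B_{\lambda_L}$ be an arbitrary path, $N=E_1(b)$, and consider the table (local energy distribution) with entry $E_{l,j}-E_{l-1,j}\in\{0,1\}$ in the $l$-th row and $j$-th column ($l\ge1$, $1\le j\le L$). Divide the letters $1$ in this table into $N$ groups by performing the following operation $N$ times, each time on the current table: starting from the rightmost $1$ in the first row, pick the nearest $1$ from each successive row, where the one picked in row $l+1$ must be weakly right of the one picked in row $l$ (i.e. one picks the $1$ in row $l+1$ with the smallest column index among those whose column index is at least that of the $1$ picked in row $l$); stop when there is no such $1$ in row $l+1$; the picked $1$'s form one group; then change all picked $1$'s into $0$. Then the groups of letters $1$ so obtained have no crossing with each other.
   Context: Crystals. For an integer $k\ge 1$, $B_k=\{(x_1,x_2)\in\mathbb{Z}_{\ge 0}^2 : x_1+x_2=k\}$. Put $u_l=(l,0)\in B_l$. A path is an element $b=b_1\otimes\cdots\otimes b_L\in B_{\lambda_1}\otimes\cdots\otimes B_{\lambda_L}$ (a sequence $(b_1,\dots,b_L)$ with $b_i\in B_{\lambda_i}$). Combinatorial $R$ and energy function. For $x=(x_1,x_2)\in B_k$ and $y=(y_1,y_2)\in B_l$, the combinatorial $R$ is the map $B_k\otimes B_l\to B_l\otimes B_k$, $x\otimes y\simeq\tilde y\otimes\tilde x$, with $\tilde x_i=x_i+Q_i-Q_{i-1}$, $\tilde y_i=y_i+Q_{i-1}-Q_i$, where $Q_i=\min(x_{i+1},y_i)$ and indices are mod $2$ (so $Q_0=Q_2=\min(x_1,y_2)$,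 $Q_1=\min(x_2,y_1)$). The energy function is $H(x\otimes y)=Q_0=\min(x_1,y_2)$. Local energies. For a path $b$ and $l\ge 1$, put $u_l^{(0)}=u_l$ and define $u_l^{(j)}\in B_l$ and $b_j'\in B_{\lambda_j}$ recursively by $u_l^{(j-1)}\otimes b_j\simeq b_j'\otimes u_l^{(j)}$. Set $E_{l,j}=H(u_l^{(j-1)}\otimes b_j)$, $E_{0,j}=0$, and $E_l=E_l(b)=\sum_{j=1}^L E_{l,j}$. Crossing. Each group contains exactly one $1$ in each of the rows $1,2,\dots,m$ for some $m\ge1$. Two groups $M_1,M_2$ cross (between rows $l$ and $l+1$) if both contain elements in rows $l$ and $l+1$, say at $(l,m_{1-}),(l+1,m_{1+})\in M_1$ and $(l,m_{2-}),(l+1,m_{2+})\in M_2$, with $m_{1-}<m_{2-}$ and $m_{2+}<m_{1+}$, or the same with the roles of $M_1$ and $M_2$ exchanged. The groups have no crossing if no two of them cross between any two successive rows. *)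

(* Defs.v *)
From mathcomp Require Import all_boot all_order all_algebra.
From mathcomp Require Import zify.
Set Implicit Arguments.
Unset Strict Implicit.
Unset Printing Implicit Defensive.

Record crystal (k : nat) := Crystal {
  coord1 : nat;
  coord2 : nat;
  coord_sum : coord1 + coord2 = k }.

Lemma highest_subproof (l : nat) : l + 0 = l.
Proof. exact: addn0. Qed.

Definition highest (l : nat) : crystal l := Crystal (highest_subproof l).

(* The indices of Q live modulo 2, so that Q2 is Q0. *)
Definition Q0 k l (x : crystal k) (y : crystal l) : nat :=
  minn (coord1 x) (coord2 y).

Definition Q1 k l (x : crystal k) (y : crystal l) : nat :=
  minn (coord2 x) (coord1 y).

(* The subtractions below never truncate: Q0 <= x1, y2 and Q1 <= x2, y1. *)
Lemma tildex_subproof k l (x : crystal k) (y : crystal l) :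
  (coord1 x + Q1 x y - Q0 x y) + (coord2 x + Q0 x y - Q1 x y) = k.
Proof. by have := coord_sum x; rewrite /Q0 /Q1; lia. Qed.

Lemma tildey_subproof k l (x : crystal k) (y : crystal l) :
  (coord1 y + Q0 x y - Q1 x y) + (coord2 y + Q1 x y - Q0 x y) = l.
Proof. by have := coord_sum y; rewrite /Q0 /Q1; lia. Qed.

Definition combR k l (x : crystal k) (y : crystal l) : crystal l * crystal k :=
  (Crystal (tildey_subproof x y), Crystal (tildex_subproof x y)).

Definition energyH k l (x : crystal k) (y : crystal l) : nat := Q0 x y.

Fixpoint tensor (lam : seq nat) : Type :=
  if lam is k :: lam' then (crystal k * tensor lam')%type else unit.

(* The values H (u^(j-1) (x) b_j), j = 1, ..., L, for the initial carrier
   u^(0) = u. *)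
Fixpoint carrier_energies l (u : crystal l) (lam : seq nat) :
    tensor lam -> seq nat :=
  match lam return tensor lam -> seq nat with
  | [::] => fun=> [::]
  | k :: lam' => fun b =>
      energyH u b.1 :: carrier_energies (combR u b.1).2 b.2
  end.

(* Columns are numbered 1, ..., L, with L = size lam. *)
Definition local_energy lam (b : tensor lam) (l j : nat) : nat :=
  if l is 0 then 0 else nth 0 (carrier_energies (highest l) b) j.-1.

Definition total_energy lam (b : tensor lam) (l : nat) : nat :=
  \sum_(1 <= j < (size lam).+1) local_energy b l j.

(* T l j is the entry in row l >= 1 and column j >= 1. *)
Definition table := nat -> nat -> int.

Definition energy_table lam (b : tensor lam) : table :=
  fun l j => ((local_energy b l j)%:Z - (local_energy b l.-1 j)%:Z)%R.

Definition ones (L : nat) (T : table) (l : nat) : seq nat :=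
  [seq j <- iota 1 L | T l j == 1%R].

(* M l is the column of the letter of the group M in row l, if there is one. *)
Definition group := nat -> option nat.

(* [ones L T l] is increasing: its last element is the rightmost 1 and the first
   of its elements that is at least m is the nearest 1 weakly right of m. *)
Definition rightmost_one (L : nat) (T : table) (l : nat) : option nat :=
  ohead (rev (ones L T l)).

Definition nearest_one (L : nat) (T : table) (l m : nat) : option nat :=
  ohead [seq j <- ones L T l | m <= j].

Fixpoint pick_group (L : nat) (T : table) (l : nat) : option nat :=
  match l with
  | 0 => None
  | 1 => rightmost_one L T 1
  | l'.+1 => obind (nearest_one L T l) (pick_group L T l')
  end.

Definition erase (M : group) (T : table) : table :=
  fun l j => if M l == Some j then 0%R else T l j.

Fixpoint table_after (L : nat) (T : table) (s : nat) : table :=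
  if s is s'.+1 then
    let T' := table_after L T s' in erase (pick_group L T') T'
  else T.

(* The group picked by the (s+1)-st operation. *)
Definition nth_group lam (b : tensor lam) (s : nat) : group :=
  pick_group (size lam) (table_after (size lam) (energy_table b) s).

Definition cross_between (M1 M2 : group) (l : nat) : Prop :=
  exists m1 m1' m2 m2' : nat,
    [/\ M1 l = Some m1, M1 l.+1 = Some m1', M2 l = Some m2, M2 l.+1 = Some m2'
      & (m1 < m2 /\ m2' < m1') \/ (m2 < m1 /\ m1' < m2')].

Definition cross (M1 M2 : group) : Prop :=
  exists2 l : nat, 1 <= l & cross_between M1 M2 l.

(* Main.v *)
Require Import Defs.
From mathcomp Require Import all_boot all_order all_algebra.
From mathcomp Require Import zify.

(** Let a_l be the number of letters 2 in the carrier of capacity l. The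
    differences d_l = a_l - a_(l-1) stay in {0,1}; in the column of (y1, y2) the
    first y2 zeros of the sequence (d_1, d_2, ...) become 1, the first y1 ones
    become 0, and the letters 1 of row l of the table mark the columns where d_l
    jumps from 0 to 1. Following the pair (d_l, d_(l+1)) shows that the rows
    interlace: each 1 of row l+1 in column r has a 1 of row l in some column
    q <= r without another 1 of row l+1 in the columns q, ..., r-1.
    In an interlaced table the group picked takes the rightmost 1 of every row
    it meets, and erasing it leaves an interlaced table. Hence in every row a
    group picked later lies strictly left of a group picked earlier. *)

Lemma mem_ones L T l j : (j \in ones L T l) = (1 <= j <= L) && (T l j == 1%R).
Proof. by rewrite mem_filter mem_iota add1n ltnS andbC. Qed.

Lemma mem_ones_erase L M T l j :
  (j \in ones L (erase M T) l) = (j \in ones L T l) && (M l != Some j).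
Proof.
by rewrite !mem_ones /erase; case: (M l == Some j); rewrite ?andbT ?andbF.
Qed.

Lemma sorted_ones L T l : sorted leq (ones L T l).
Proof. exact: (sorted_filter leq_trans _ (iota_sorted 1 L)). Qed.

Lemma ohead_sorted_min {s : seq nat} {m} :
  sorted leq s -> ohead s = Some m -> m \in s /\ {in s, forall j, m <= j}.
Proof.
case: s => //= a s /(order_path_min leq_trans)/allP sP [<-].
split=> [|j]; first by rewrite inE eqxx.
by rewrite inE => /predU1P[-> //|/sP].
Qed.

Lemma rightmost_oneP L T l m : rightmost_one L T l = Some m ->
  m \in ones L T l /\ {in ones L T l, forall j, j <= m}.
Proof.
rewrite /rightmost_one; have := sorted_ones L T l.
case/lastP: (ones L T l) => [|s a] //=; rewrite rev_rcons /= => + [<-].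
rewrite -rev_sorted rev_rcons /=.
move=> /(order_path_min (fun _ _ _ h1 h2 => leq_trans h2 h1))/allP sP.
split=> [|j]; first by rewrite mem_rcons inE eqxx.
by rewrite mem_rcons inE => /predU1P[-> //|js]; apply: sP; rewrite mem_rev.
Qed.

Lemma nearest_oneP L T l m n : nearest_one L T l m = Some n ->
  [/\ n \in ones L T l, m <= n & {in ones L T l, forall j, m <= j -> n <= j}].
Proof.
have sorted_s := sorted_filter leq_trans (leq m) (sorted_ones L T l).
move=> /(ohead_sorted_min sorted_s) [].
rewrite mem_filter => /andP[mn nT] nmin; split=> // j jT mj.
by apply: nmin; rewrite mem_filter mj.
Qed.

Lemma nearest_one_None L T l m : nearest_one L T l m = None ->
  {in ones L T l, forall j, j < m}.
Proof.
rewrite /nearest_one => E j jT; rewrite ltnNge; apply/negP=> mj.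
have : j \in [seq j <- ones L T l | m <= j] by rewrite mem_filter mj.
by move: E; case: filter.
Qed.

Definition interlaced L (T : table) : Prop :=
  forall l r, 0 < l -> r \in ones L T l.+1 ->
  exists q, [/\ q \in ones L T l, q <= r
    & {in ones L T l.+1, forall r', q <= r' -> r <= r'}].

(** Let the group go from [n], rightmost in its row, to [m]. The witness [q] of any 1 of the next
    row in column [j] satisfies [q <= n <= m], and interlacing applied to [m] gives [j <= m]. *)
Lemma pick_group_rightmost L T l m : interlaced L T ->
  pick_group L T l = Some m ->
  m \in ones L T l /\ {in ones L T l, forall j, j <= m}.
Proof.
move=> TI; elim: l m => [//|[|l] IH] m; first exact: rightmost_oneP.
rewrite [pick_group _ _ _]/(obind _ (pick_group L T l.+1)).
case E: (pick_group L T l.+1) => [n|//] /= /nearest_oneP[mT nm mmin].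
have [nT nmax] := IH _ E; split=> // j jT.
have [q [/nmax qn qj /(_ _ mT)]] := TI _ _ (ltn0Sn l) jT.
by apply; apply: leq_trans nm.
Qed.

(** The old witness [q] for [r] survives: if [q] were picked, its nearest 1 in the next row would be
    [r], and [r] would be erased as well. *)
Lemma interlaced_erase L T : interlaced L T ->
  interlaced L (erase (pick_group L T) T).
Proof.
move=> TI [//|l] r _; rewrite mem_ones_erase => /andP[rT rM].
have [q [qT qr qmin]] := TI _ _ (ltn0Sn l) rT.
exists q; split=> //; last first.
  by move=> r'; rewrite mem_ones_erase => /andP[/qmin].
rewrite mem_ones_erase qT; apply/eqP => qM; move: rM.
rewrite [pick_group _ _ _]/(obind _ (pick_group L T l.+1)) qM /=.
case E: nearest_one => [n|]; last first.
  by have := nearest_one_None _ _ _ _ E _ rT; rewrite ltnNge qr.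
have [nT qn nmin] := nearest_oneP _ _ _ _ _ E.
by rewrite (_ : n = r) ?eqxx //; apply/eqP; rewrite eqn_leq qmin // nmin.
Qed.

Lemma interlaced_table_after L T s :
  interlaced L T -> interlaced L (table_after L T s).
Proof. by move=> TI; elim: s => //= s; apply: interlaced_erase. Qed.

Lemma ones_table_afterS L T s k l :
  {subset ones L (table_after L T (s + k).+1) l
    <= ones L (table_after L T s.+1) l}.
Proof.
elim: k => [|k IH] j; first by rewrite addn0.
by rewrite addnS [table_after _ _ _]/= mem_ones_erase => /andP[/IH].
Qed.

Lemma pick_group_table_after_lt L T s t l m n : interlaced L T -> s < t ->
  pick_group L (table_after L T s) l = Some m ->
  pick_group L (table_after L T t) l = Some n -> n < m.
Proof.
move=> TI lt_st mE nE; have [k tE] : exists k, t = (s + k).+1.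
  by exists (t - s.+1); lia.
have [_ mmax] := pick_group_rightmost _ _ _ _ (interlaced_table_after _ _ s TI) mE.
have [nT _] := pick_group_rightmost _ _ _ _ (interlaced_table_after _ _ t TI) nE.
(* Column [n] still holds a 1 after the erasure of the group [s], so [n <= m] and [n] differs from
   [m]. *)
move: nT; rewrite tE => /ones_table_afterS; rewrite /= mem_ones_erase mE.
case/andP=> /mmax; rewrite leq_eqVlt => /predU1P[-> |//].
by rewrite eqxx.
Qed.

(* The last alternative is needed for the induction: when (d_l, d_(l+1)) starts
   at (1, 0), the first 1 of row l+1 may have no 1 of row l before it. *)
Lemma carrier_energies_interlaced lam (b : tensor lam) l
    (u : crystal l) (v : crystal l.+1) (w : crystal l.+2) (r : nat) :
  let eu := nth 0 (carrier_energies u b) in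
  let ev := nth 0 (carrier_energies v b) in
  let ew := nth 0 (carrier_energies w b) in
  coord2 u <= coord2 v <= (coord2 u).+1 ->
  coord2 v <= coord2 w <= (coord2 v).+1 ->
  ew r = (ev r).+1 ->
  (exists q, [/\ ev q = (eu q).+1, q <= r
     & forall r', ew r' = (ev r').+1 -> q <= r' -> r <= r'])
  \/ [/\ coord2 v = (coord2 u).+1, coord2 w = coord2 v
     & forall r', ew r' = (ev r').+1 -> r <= r'].
Proof.
elim: lam b u v w r => [|k lam IH] /= b u v w r huv hvw; first by rewrite !nth_nil.
have [[su sv] sw] := (coord_sum u, coord_sum v, coord_sum w).
case: r => [|r] /=.
  rewrite /energyH /Q0 => hr.
  (* The jump in this column forces d_(l+1) = 0 beforehand. If d_l = 0 too, it is filled before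
     d_(l+1), hence jumps in the same column. *)
  have [hd|hd] := eqVneq (coord2 v) (coord2 u).
    by left; exists 0; split=> //=; lia.
  by right; split=> //; lia.
set u' := (combR u b.1).2; set v' := (combR v b.1).2; set w' := (combR w b.1).2.
have huv' : coord2 u' <= coord2 v' <= (coord2 u').+1.
  by rewrite /= /Q0 /Q1; lia.
have hvw' : coord2 v' <= coord2 w' <= (coord2 v').+1.
  by rewrite /= /Q0 /Q1; lia.
move=> /(IH b.2 u' v' w' r huv' hvw') [[q [hq qr qmin]]|[hv hw rmin]].
  by left; exists q.+1; split=> // -[|r'] //= /qmin; apply.
(* A jump of d_(l+1) here would leave it at 1, but [hw] says that it is 0 after this column. *)
have hr0 : energyH w b.1 <> (energyH v b.1).+1.
  by move: hv hw; rewrite /u' /v' /w' /energyH /= /Q0 /Q1; lia.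
have rmin' : forall r', nth 0 (energyH w b.1 :: carrier_energies w' b.2) r' =
    (nth 0 (energyH v b.1 :: carrier_energies v' b.2) r').+1 -> r < r'.
  by move=> [|r'] //= /rmin.
have [h|h] := eqVneq (energyH v b.1) (energyH u b.1).+1.
  by left; exists 0; split=> // r' /rmin'.
(* Without a jump, d_l was already 1 and stayed 1. The column thus lowers only ones before position
   l, so d_(l+1) was already 0. *)
right; split=> //; move: h hv hw; rewrite /u' /v' /w' /energyH /= /Q0 /Q1; lia.
Qed.

(** In capacity 0 [coord1] is always 0, so the convention for row 0 agrees with the general
    formula. *)
Lemma local_energyE lam (b : tensor lam) l j :
  local_energy b l j = nth 0 (carrier_energies (highest l) b) j.-1.
Proof.
case: l => //=; suff /all_pred1P -> : all (pred1 0)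
  (carrier_energies (highest 0) b) by rewrite nth_nseq if_same.
elim: lam b (highest 0) => //= k lam IH b u; rewrite IH andbT.
by rewrite /energyH /Q0; have := coord_sum u; lia.
Qed.

Lemma mem_ones_energy_table lam (b : tensor lam) l j :
  (j \in ones (size lam) (energy_table b) l.+1) = (1 <= j <= size lam) &&
  (nth 0 (carrier_energies (highest l.+1) b) j.-1
    == (nth 0 (carrier_energies (highest l) b) j.-1).+1).
Proof. by rewrite mem_ones /energy_table !local_energyE [l.+1.-1]/=; congr andb; lia. Qed.

Lemma interlaced_energy_table lam (b : tensor lam) :
  interlaced (size lam) (energy_table b).
Proof.
move=> [//|l] r _; rewrite mem_ones_energy_table => /andP[rL /eqP hr].
(* All three carriers start with [coord2] equal to 0, which rules out the last alternative. *)
have [//|//|[q [hq qr qmin]]|[]//] :=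
  carrier_energies_interlaced lam b l (highest _) (highest _) (highest _) _ _ _ hr.
exists q.+1; rewrite mem_ones_energy_table; split; [|lia|].
  by rewrite /= hq eqxx andbT; lia.
move=> r'; rewrite mem_ones_energy_table => /andP[r'L /eqP/qmin]; lia.
Qed.

Theorem proposition4p4 (lam : seq nat) (lam_gt0 : all (fun k => 1 <= k) lam)
    (b : tensor lam) (s t : nat) :
  s < total_energy b 1 -> t < total_energy b 1 -> s <> t ->
  ~ cross (nth_group b s) (nth_group b t).
Proof.
move=> _ _ st [l _ [m1 [m1' [m2 [m2' [h1 h1' h2 h2' h]]]]]].
have lt_groups := fun s t l m n => pick_group_table_after_lt
  (size lam) (energy_table b) s t l m n (interlaced_energy_table lam b).
case: (ltngtP s t) => // lt_st.
  have := lt_groups _ _ _ _ _ lt_st h1 h2.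
  by have := lt_groups _ _ _ _ _ lt_st h1' h2'; lia.
have := lt_groups _ _ _ _ _ lt_st h2 h1.
by have := lt_groups _ _ _ _ _ lt_st h2' h1'; lia.
Qed.
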